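(* Let $X$ be the complete cubical complex of dimension $3$ on a finite linearly ordered vertex set $V$ with $|V|\ge 10$. Then the second cohomology of $X$ with coefficients in $\mu_2$ is $H^2(X)\cong\mu_2\times\mu_2$. Explicitly, $Z^2(X)=\langle -\mathbf{1},[-1],B^2(X)\rangle$ and $B^2(\vec{X})=\langle -[-1],B^2(X)\rangle$ (subgroups generated by the indicated elements and subgroup).
   Context: $\mu_2=\{1,-1\}$ (multiplicative group). The complete cubical complex of dimension $3$ on $V$ has: $X_0=V$; $X_1$ = unordered pairs of distinct vertices; $X_2$ (squares) = all $4$-element subsets of $V$ endowed with the graph structure of a $4$-cycle, $(ijk\ell)$ denoting the square with edges $ij,jk,k\ell,\ell i$; $X_3$ (cubes) = all $8$-element subsets of $V$ endowed with the graph structure of $\{0,1\}^3$, each having six square faces. $C^d(X)$ is the group of functions $X_d\to\mu_2$ under pointwise multiplication; constant functions are $\pm\mathbf{1}$. $(\delta^0\alpha)_{ij}=\alpha_i\alpha_j$, $(\delta^1f)_{ijk\ell}=f_{ij}f_{jk}f_{k\ell}f_{\ell i}$, and $(\delta^2g)_c$ is the product of $g$ over the six square faces of the cube $c$. $Z^d(X)=\ker\delta^d$, $B^d(X)=\operatorname{Im}\delta^{d-1}$, $H^d(X)=Z^d(X)/B^d(X)$. $C^1(\vec{X})$ is the group of functions from ordered pairs of distinct vertices to $\mu_2$; $C^1(X)\subseteq C^1(\vec X)$ are the symmetric ones. The norm $N:C^1(\vec{X})\to C^1(X)$ is $(Nf)_{ij}=f_{ij}f_{ji}$, and $C^1(\vec{X})'=\{f\in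 C^1(\vec{X}): Nf\in Z^1(X)\}$. For $f\in C^1(\vec X)$ put $(\vec{\delta}^1f)_{ijk\ell}=f_{ij}f_{kj}f_{k\ell}f_{i\ell}$ on ordered $4$-tuples of distinct vertices; for $f\in C^1(\vec{X})'$ this is invariant under the dihedral group $D_4$ and so is an element of $C^2(X)$. $B^2(\vec{X})=\{\vec{\delta}^1f: f\in C^1(\vec{X})'\}\subseteq C^2(X)$. $[-1]\in C^2(X)$ is defined by $[-1]_c=+1$ if the vertices of the square $c$ can be read in increasing order going around $c$ (i.e. $c=(ijk\ell)$ with $i<j<k<\ell$), and $[-1]_c=-1$ otherwise. $-[-1]$ is its pointwise negative. *)

(* Defs.v *)
From HB Require Import structures.
From mathcomp Require Import all_boot all_order all_algebra all_fingroup.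

Set Implicit Arguments.
Unset Strict Implicit.
Unset Printing Implicit Defensive.

Import GroupScope.

Definition mu2 : Type := seq_sub [:: 1%R; (-1)%R : int].
HB.instance Definition _ := Finite.on mu2.

Lemma mu2_mul_subproof (x y : mu2) :
  (ssval x * ssval y)%R \in [:: 1%R; (-1)%R : int].
Proof.
have := ssvalP x; have := ssvalP y.
by rewrite !inE => /orP[]/eqP-> /orP[]/eqP->.
Qed.

Definition mu2_mul (x y : mu2) : mu2 := SeqSub (mu2_mul_subproof x y).
Definition mu2_one : mu2 := @SeqSub _ [:: 1%R; (-1)%R : int] 1%R isT.
Definition mu2_opp1 : mu2 := @SeqSub _ [:: 1%R; (-1)%R : int] (-1)%R isT.

Lemma mu2_mulA : associative mu2_mul.
Proof. by move=> x y z; apply: val_inj; rewrite /= GRing.mulrA. Qed.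
Lemma mu2_mul1 : left_id mu2_one mu2_mul.
Proof. by move=> x; apply: val_inj; rewrite /= GRing.mul1r. Qed.
Lemma mu2_mulV : left_inverse mu2_one id mu2_mul.
Proof.
move=> x; apply: val_inj => /=.
by have := ssvalP x; rewrite !inE => /orP[]/eqP->.
Qed.

HB.instance Definition _ :=
  Finite_isGroup.Build mu2 mu2_mulA mu2_mul1 mu2_mulV.

Lemma mu2C : @commutative mu2 mu2 mulg.
Proof. by move=> x y; apply: val_inj; rewrite /= GRing.mulrC. Qed.

HB.instance Definition _ := SemiGroup.isCommutativeLaw.Build mu2 mulg mu2C.

Lemma mu2K (x : mu2) : x * x = 1.
Proof. exact: mu2_mulV. Qed.

Notation cochain T := {dffun forall _ : T, mu2}.

Section Complex.
Variable V : finType.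
Implicit Types (i j k l : V) (e : {set V}) (c : {set {set V}}).

(* A 4-cycle, and likewise a cube graph, has no isolated vertex; it is thus
   determined by its set of edges, by which it is represented. *)
Definition square i j k l : {set {set V}} :=
  [set [set i; j]; [set j; k]; [set k; l]; [set l; i]].

Definition is_square c : bool :=
  [exists t : V * V * V * V, let: (i, j, k, l) := t in
    uniq [:: i; j; k; l] && (c == square i j k l)].

Definition cube_vertex : finType := (bool * bool * bool)%type.

Definition cube_adj (x y : cube_vertex) : bool :=
  (x.1.1 != y.1.1) + (x.1.2 != y.1.2) + (x.2 != y.2) == 1%N.

Definition cube (phi : {ffun cube_vertex -> V}) : {set {set V}} :=
  [set [set phi p.1; phi p.2] | p : cube_vertex * cube_vertex
                              & cube_adj p.1 p.2].

Definition is_cube c : bool :=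
  [exists phi : {ffun cube_vertex -> V}, injectiveb phi && (c == cube phi)].

Definition X1 : finType := {e : {set V} | #|e| == 2}.
Definition X2 : finType := {c : {set {set V}} | is_square c}.
Definition X3 : finType := {c : {set {set V}} | is_cube c}.
Definition vecX1 : finType := {p : V * V | p.1 != p.2}.

Definition delta1 (f : cochain X1) : cochain X2 :=
  [ffun c : X2 => \prod_(e : X1 | val e \in val c) f e].

(* The 4-cycles contained in the graph of a cube are exactly its six square
   faces, see [square_sub_cube]. *)
Definition delta2 (g : cochain X2) : cochain X3 :=
  [ffun c : X3 => \prod_(s : X2 | val s \subset val c) g s].

Lemma delta1M : {in [set: cochain X1] &, {morph delta1 : a b / a * b}}.
Proof.
move=> a b _ _; apply/ffunP=> e; rewrite !ffunE -big_split /=.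
by apply: eq_bigr => i _; rewrite ffunE.
Qed.
Lemma delta2M : {in [set: cochain X2] &, {morph delta2 : a b / a * b}}.
Proof.
move=> a b _ _; apply/ffunP=> e; rewrite !ffunE -big_split /=.
by apply: eq_bigr => i _; rewrite ffunE.
Qed.
Canonical delta1_morphism := Morphism delta1M.
Canonical delta2_morphism := Morphism delta2M.

Definition Z1 : {set cochain X1} := 'ker delta1.
Definition Z2 : {set cochain X2} := 'ker delta2.
Definition B2 : {set cochain X2} := delta1 @* [set: cochain X1].
Canonical Z1_group := [group of Z1].
Canonical Z2_group := [group of Z2].
Canonical B2_group := [group of B2].
Definition H2 := Z2 / B2.

(* The default value is only taken when i = j. *)
Definition vec_at (f : cochain vecX1) i j : mu2 :=
  if insub (i, j) is Some p then f p else 1.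

Definition norm (f : cochain vecX1) : cochain X1 :=
  [ffun e : X1 => \prod_(p : vecX1 | [set (val p).1; (val p).2] == val e) f p].

Definition vecC1' : {set cochain vecX1} := [set f | norm f \in Z1].

Definition vecdelta1_at (f : cochain vecX1) i j k l : mu2 :=
  vec_at f i j * vec_at f k j * vec_at f k l * vec_at f i l.

(* The value on a square is read off an arbitrary labelling (ijkl) of it; for f
   in vecC1' it does not depend on the labelling, see [vecdelta1E]. *)
Definition vecdelta1 (f : cochain vecX1) : cochain X2 :=
  [ffun c : X2 => let: (i, j, k, l) := xchoose (existsP (valP c)) in
    vecdelta1_at f i j k l].

Definition vecB2 : {set cochain X2} := vecdelta1 @: vecC1'.

Definition cst_opp1 : cochain X2 := [ffun=> mu2_opp1].

Definition edge_at (f : cochain X1) i j : mu2 :=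
  if insub [set i; j] is Some e then f e else 1.

Lemma big_sub_seq (T : finType) (P : pred T) (f : cochain {x | P x}) s :
    uniq s ->
  \prod_(e : {x | P x} | val e \in s) f e =
    \prod_(x <- s) (if insub x is Some e then f e else 1).
Proof.
elim: s => [|x s IHs] /=; first by rewrite big_nil big_pred0.
case/andP=> xNs /IHs {}IHs; rewrite big_cons -IHs.
case: insubP => [e _ ex | xNP].
  rewrite (bigD1 e) /=; last by rewrite inE -ex eqxx.
  congr (_ * _); apply: eq_bigl => e'; rewrite inE -(inj_eq val_inj) ex.
  by case: eqVneq => [->|]; rewrite ?andbT // andbF (negPf xNs).
rewrite mul1g; apply: eq_bigl => e; rewrite inE.
by case: eqP => // ex; case/negP: xNP; rewrite -ex (valP e).
Qed.

Lemma set2_inj (T : finType) (a b c d : T) :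
  [set a; b] = [set c; d] -> (a = c /\ b = d) \/ (a = d /\ b = c).
Proof.
move=> E; have: a \in [set c; d] by rewrite -E set21.
have: b \in [set c; d] by rewrite -E set22.
have: d \in [set a; b] by rewrite E set22.
have: c \in [set a; b] by rewrite E set21.
do 4![case/set2P=> ?]; subst; by [left | right].
Qed.

Lemma delta1E f (c : X2) i j k l :
    uniq [:: i; j; k; l] -> val c = square i j k l ->
  delta1 f c = edge_at f i j * edge_at f j k * edge_at f k l * edge_at f l i.
Proof.
move=> u cE; rewrite ffunE.
pose s := [:: [set i; j]; [set j; k]; [set k; l]; [set l; i]].
rewrite (eq_bigl (fun e : X1 => val e \in s)); last first.
  by move=> e; rewrite cE !inE -!orbA.
rewrite big_sub_seq; first by rewrite !big_cons big_nil mulg1 !mulgA.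
move: u; rewrite /= !inE !negb_or.
case/and4P=> /and3P[ij ik il] /andP[jk jl] kl _.
by rewrite !andbT -!andbA; apply/and5P; split; [..|apply/andP; split];
  apply/eqP=> /set2_inj[][? ?]; subst;
  rewrite ?eqxx in ij ik il jk jl kl.
Qed.

Lemma normE f i j :
  i != j -> edge_at (norm f) i j = vec_at f i j * vec_at f j i.
Proof.
move=> ij; rewrite /edge_at insubT ?cards2 ?ij // => ije; rewrite ffunE /=.
rewrite (eq_bigl (fun p : vecX1 => val p \in [:: (i, j); (j, i)])).
  by rewrite big_sub_seq ?big_cons ?big_nil ?mulg1 //= inE xpair_eqE (negPf ij).
case=> [[a b] ab] /=; rewrite !inE; apply/eqP/idP => [/set2_inj[][-> ->]|].
- by rewrite eqxx.
- by rewrite eqxx orbT.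
- by case/orP=> /eqP[-> ->] //; rewrite setUC.
Qed.

Lemma square_dihedral i j k l i' j' k' l' :
    uniq [:: i; j; k; l] -> uniq [:: i'; j'; k'; l'] ->
    square i j k l = square i' j' k' l' ->
  (i', j', k', l') \in
    [:: (i, j, k, l); (j, k, l, i); (k, l, i, j); (l, i, j, k);
        (l, k, j, i); (k, j, i, l); (j, i, l, k); (i, l, k, j)].
Proof.
move=> u u' E.
have: [set i'; j'] \in square i j k l by rewrite E !inE eqxx.
have: [set j'; k'] \in square i j k l by rewrite E !inE eqxx ?orbT.
have: [set k'; l'] \in square i j k l by rewrite E !inE eqxx ?orbT.
have: [set l'; i'] \in square i j k l by rewrite E !inE eqxx ?orbT.
move: u u' {E}; rewrite /= !inE !negb_or.
case/and4P=> /and3P[ij ik il] /andP[jk jl] kl _.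
case/and4P=> /and3P[ij' ik' il'] /andP[jk' jl'] kl' _.
move=> E4 E3 E2; rewrite -!orbA.
case/or4P=> /eqP/set2_inj[][? ?]; subst; move: E2;
case/orP=> [/orP[/orP[]|]|] /eqP/set2_inj[][? ?]; subst;
  rewrite ?eqxx in ij ik il jk jl kl ij' ik' il' jk' jl' kl' => //;
move: E3;
case/orP=> [/orP[/orP[]|]|] /eqP/set2_inj[][? ?]; subst;
  rewrite ?eqxx in ij ik il jk jl kl ij' ik' il' jk' jl' kl' => //;
by rewrite !eqxx ?orbT.
Qed.

Lemma vecdelta1E f (c : X2) i j k l :
    f \in vecC1' -> uniq [:: i; j; k; l] -> val c = square i j k l ->
  vecdelta1 f c = vecdelta1_at f i j k l.
Proof.
move=> fC u cE; have: delta1 (norm f) c = 1.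
  by move: fC; rewrite inE => /mker ->; rewrite ffunE.
rewrite (delta1E _ u cE) !normE; first last.
- by move: u; rewrite /= !inE !negb_or; case/and4P=> /and3P[].
- by move: u; rewrite /= !inE !negb_or; case/and4P=> _ /andP[].
- by move: u; rewrite /= !inE !negb_or; case/and4P.
- by rewrite eq_sym; move: u; rewrite /= !inE !negb_or; case/and4P=> /and3P[].
move=> N1; rewrite ffunE; case: (xchoose _) (xchooseP (existsP (valP c))).
move=> [[i' j'] k'] l' /andP[u' /eqP]; rewrite cE => /(square_dihedral u u').
rewrite !inE /vecdelta1_at.
have pq : vec_at f i j * vec_at f k j * vec_at f k l * vec_at f i l =
          vec_at f j k * vec_at f l k * vec_at f l i * vec_at f j i.
  set q := RHS; apply: (mulIg q); rewrite mu2K -N1 /q.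
  by rewrite (AC (4 * 4) ((1 * 8) * (5 * 2) * (3 * 6) * (7 * 4)))%AC.
do 7?[case/orP]; move=> /eqP[-> -> -> ->] //; rewrite ?pq //.
- by rewrite -pq (ACl (3 * 4 * 1 * 2))%AC.
- by rewrite (ACl (3 * 4 * 1 * 2))%AC.
- by rewrite (ACl (2 * 1 * 4 * 3))%AC.
- by rewrite -pq (ACl (2 * 1 * 4 * 3))%AC.
- by rewrite (ACl (4 * 3 * 2 * 1))%AC.
- by rewrite -pq (ACl (4 * 3 * 2 * 1))%AC.
Qed.

Definition cube_faces (phi : {ffun cube_vertex -> V}) : seq {set {set V}} :=
  [seq square (phi (b, false, false)) (phi (b, false, true))
              (phi (b, true, true)) (phi (b, true, false))
     | b <- [:: false; true]] ++
  [seq square (phi (false, b, false)) (phi (false, b, true))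
              (phi (true, b, true)) (phi (true, b, false))
     | b <- [:: false; true]] ++
  [seq square (phi (false, false, b)) (phi (false, true, b))
              (phi (true, true, b)) (phi (true, false, b))
     | b <- [:: false; true]].

Lemma square_rot i j k l : square i j k l = square j k l i.
Proof. by rewrite /square [RHS]setUC !setUA. Qed.

Lemma square_rev i j k l : square i j k l = square l k j i.
Proof.
rewrite /square (setUC [set l] [set k]) (setUC [set k] [set j]).
rewrite (setUC [set j] [set i]) (setUC [set i] [set l]).
by congr (_ :|: _); rewrite setUC setUA setUAC.
Qed.

Lemma edge_cube (phi : {ffun cube_vertex -> V}) x y : injective phi ->
  ([set phi x; phi y] \in cube phi) = cube_adj x y.
Proof.
move=> phiI; apply/imsetP/idP => [[[a b]]|xy]; last by exists (x, y); rewrite ?inE.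
rewrite inE /= => ab /set2_inj[][/phiI-> /phiI->] //.
by case: a b ab => [[[] []] []] [[[] []] []].
Qed.

Lemma cube_4cycle (phi : {ffun cube_vertex -> V}) (x y z w : cube_vertex) :
    uniq [:: x; y; z; w] ->
    cube_adj x y -> cube_adj y z -> cube_adj z w -> cube_adj w x ->
  square (phi x) (phi y) (phi z) (phi w) \in cube_faces phi.
Proof.
move=> u; case: x u => [[[] []] []] u; case: y u => [[[] []] []] // u _;
  case: z u => [[[] []] []] // u _; case: w u => [[[] []] []] // _ _ _;
rewrite /cube_faces /=;
do 4?[by rewrite ?inE eqxx ?orbT | rewrite square_rot];
rewrite square_rev; do 4?[by rewrite ?inE eqxx ?orbT | rewrite square_rot].
Qed.

Lemma square_sub_cube (phi : {ffun cube_vertex -> V}) i j k l :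
    injective phi -> uniq [:: i; j; k; l] ->
  (square i j k l \subset cube phi) = (square i j k l \in cube_faces phi).
Proof.
move=> phiI u; apply/subsetP/idP => [sub|].
  have adjP a b : [set a; b] \in square i j k l ->
      exists x y, [/\ a = phi x, b = phi y & cube_adj x y].
    move=> /sub abc; case/imsetP: (abc) => -[x y] _ /set2_inj[][aE bE];
    by subst; do 2!eexists; split; rewrite // -(edge_cube _ _ phiI).
  have /adjP[x [y [iE jE xy]]]: [set i; j] \in square i j k l.
    by rewrite !inE eqxx.
  have /adjP[z [w [kE lE zw]]]: [set k; l] \in square i j k l.
    by rewrite !inE eqxx ?orbT.
  subst; have yz: cube_adj y z.
    by rewrite -(edge_cube _ _ phiI) sub // !inE eqxx ?orbT.
  have wx: cube_adj w x.
    by rewrite -(edge_cube _ _ phiI) sub // !inE eqxx ?orbT.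
  apply: cube_4cycle => //; move: u.
  by rewrite -(map_inj_uniq phiI).
rewrite /cube_faces /= !inE => h e.
by case/or4P: h => [||| /or3P[]] /eqP->; rewrite !inE -!orbA;
  case/or4P=> /eqP->; rewrite edge_cube.
Qed.

End Complex.

Definition order_sign (d : Order.disp_t) (V : finOrderType d) :
    cochain (X2 V) :=
  [ffun c : X2 V =>
    if [exists t : V * V * V * V, let: (i, j, k, l) := t in
         [&& (i < j)%O, (j < k)%O, (k < l)%O & val c == square i j k l]]
    then 1 else mu2_opp1].

(* Main.v *)
(* Write the cochains additively. For a 2-cochain g let theta(g) be its sum over
   the three squares of a complete bipartite graph K_{2,3}. The prism over
   K_{2,3} consists of three cubes whose lateral faces cancel in pairs, so for a
   2-cocycle theta takes the same value on any two disjoint K_{2,3}; since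
   |V| >= 10 this forces theta(g) to be constant, and adding the constant
   cochain we may assume theta(g) = 0. Then g vanishes on all K_{2,3}, and two
   successive splittings of functions satisfying a triangle identity write g as
   the vecdelta1 of some f. The norm of such an f is a 1-cocycle of the
   complete graph, hence of the form c + a_i + a_j; up to a term killed by
   vecdelta1, f is symmetric if c = 0 and differs from a symmetric cochain by
   the orientation of V if c = 1, whose image is -[-1]. Finally theta and the
   sum over the three squares of a K_4 separate the four classes. *)
Require Import Defs.
From mathcomp Require Import all_boot all_order all_algebra all_fingroup.
Import GroupScope.

Set Implicit Arguments.
Unset Strict Implicit.
Unset Printing Implicit Defensive.

(** * Case analysis on signs *)

Lemma mu2P (x : mu2) : x = 1 \/ x = mu2_opp1.
Proof.
have := ssvalP x; rewrite !inE => /orP[]/eqP xE; [left | right];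
  by apply: val_inj.
Qed.

Ltac mu2_cases x := case: (mu2P x) => ->.

Lemma mu2NN : mu2_opp1 * mu2_opp1 = 1. Proof. exact: mu2K. Qed.

Lemma mu2N1 : mu2_opp1 <> 1. Proof. by move/(congr1 val). Qed.

Lemma mu2_mul_eq1 (x y : mu2) : x * y = 1 -> x = y.
Proof. by move=> xy; apply: (mulIg y); rewrite mu2K. Qed.

Ltac mu2_solve := rewrite ?(mul1g, mulg1, mu2NN); try done;
  try by [move/mu2N1 | move/esym/mu2N1].

Ltac distinct :=
  repeat match goal with
  | H : is_true (uniq _) |- _ => move: H; rewrite /= => H
  | H : is_true (~~ in_mem _ (mem (_ :: _))) |- _ =>
      move: H; rewrite ?inE ?negb_or => H
  | H : is_true (_ && _) |- _ =>
      let h1 := fresh "ne" in let h2 := fresh "ne" in case/andP: H => h1 h2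
  end;
  rewrite /= ?inE ?negb_or ?andbT -?andbA;
  repeat (apply/andP; split); try assumption; try (rewrite eq_sym; assumption).

(** * Splitting sign functions, and exchanges in a finite set *)

Section Mu2Functions.
Variable T : finType.

(** Fix a base point [p] and take [S x p] as potential: the triangle through [p] recovers [S x y].
    The diagonal value [S p p] is unconstrained, hence the value 1 at [p]. *)
Lemma mu2_coboundary (P : pred T) (S : T -> T -> mu2) :
    (forall x y, P x -> P y -> x != y -> S x y = S y x) ->
    (forall x y z, P x -> P y -> P z -> uniq [:: x; y; z] ->
       S x y * S y z * S z x = 1) ->
  exists H : T -> mu2, forall x y, P x -> P y -> x != y -> S x y = H x * H y.
Proof.
move=> Ssym SK; case: (pickP P) => [p Pp | P0]; last first.
  by exists (fun=> 1) => x y; rewrite P0.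
exists (fun x => if x == p then 1 else S x p) => x y Px Py.
have [->|xp] := eqVneq x p; have [->|yp] := eqVneq y p; rewrite ?eqxx //.
- by move=> _; rewrite mul1g [RHS]Ssym.
- by move=> _; rewrite mulg1.
move=> xy; rewrite (Ssym y p) //; have: S x y * S y p * S p x = 1.
  by apply: SK => //; distinct.
rewrite (Ssym x p) // (Ssym y p) //.
by mu2_cases (S x y); mu2_cases (S p y); mu2_cases (S p x); mu2_solve.
Qed.

Lemma exists_notin (s : seq T) : size s < #|T| -> exists x, x \notin s.
Proof.
move=> sT; apply/existsP; apply: contraLR sT.
rewrite negb_exists -leqNgt => /forallP sP; rewrite cardE uniq_leq_size //.
  exact: enum_uniq.
by move=> x _; have := sP x; rewrite negbK.
Qed.

Lemma exists_uniq_notin n (s : seq T) : size s + n <= #|T| ->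
  exists t, [/\ uniq t, size t = n & {in t, forall x, x \notin s}].
Proof.
elim: n s => [|n IHn] s sT; first by exists [::].
have [|x xs] := @exists_notin s.
  by apply: leq_trans sT; rewrite addnS ltnS leq_addr.
have [|t [ut st ts]] := IHn (x :: s); first by rewrite addSnnS.
exists (x :: t); split=> /=; rewrite ?st //.
  by rewrite ut andbT; apply/negP => /ts; rewrite mem_head.
move=> y; rewrite inE => /orP[/eqP-> //|/ts]; rewrite inE negb_or; by case/andP.
Qed.

(** Induction on the number of entries of [s] outside [t]: as the sizes agree, such an entry can be
    exchanged for an entry of [t] missing from [s]. *)
Lemma uniq_seq_connected (U : Type) (k : nat) (F : seq T -> U) :
    (forall s t, size s = k -> uniq s -> perm_eq s t -> F s = F t) ->
    (forall x y s, size s = k.-1 -> uniq [:: x, y & s] ->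
       F (x :: s) = F (y :: s)) ->
  forall s t, uniq s -> uniq t -> size s = k -> size t = k -> F s = F t.
Proof.
move=> Fperm Fexch s t us ut sk tk.
have [m le_m] := ubnP (count [predC t] s).
elim: m => // m IHm in s us sk le_m *.
have [/allP st | /allPn[x xs /= xt]] := boolP (all (mem t) s).
  apply: Fperm => //; apply: uniq_perm => //.
  by apply: (uniq_min_size us st _).2; rewrite sk tk.
have [y yt ys] : exists2 y, y \in t & y \notin s.
  apply/allPn; apply: contra xt => /allP ts.
  by rewrite (uniq_min_size ut ts _).2 // sk tk.
have sE := perm_to_rem xs.
have ury : uniq [:: x, y & rem x s].
  rewrite (perm_uniq (s2 := y :: s)) /= ?ys //.
  by rewrite (perm_catCA [:: x] [:: y]) perm_cons perm_sym.
rewrite (Fperm s _ sk us sE) (Fexch x y) ?size_rem ?sk //.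
apply: IHm; first by case/andP: ury.
  by rewrite /= size_rem // sk prednK // -sk; case: (s) xs.
by move: le_m; rewrite (seq.permP sE) /= xt yt.
Qed.

End Mu2Functions.

(** * Values of 2-cochains on labelled squares *)

Section Squares.
Variable V : finType.
Implicit Types (g : cochain (X2 V)) (i j k l : V).

(** The default is met only for repeated labels, which do not give a 4-cycle. Totality lets the
    dihedral identities below hold without side conditions. *)
Definition square_at g i j k l : mu2 :=
  if insub (square i j k l) is Some c then g c else 1.

Lemma square_at_rot g i j k l : square_at g i j k l = square_at g j k l i.
Proof. by rewrite /square_at square_rot. Qed.

Lemma square_at_rev g i j k l : square_at g i j k l = square_at g l k j i.
Proof. by rewrite /square_at square_rev. Qed.

Lemma square_at_flip g i j k l : square_at g i j k l = square_at g j i l k.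
Proof. by rewrite square_at_rev 2!square_at_rot. Qed.

Lemma square_at_swap g i j k l : square_at g i j k l = square_at g i l k j.
Proof. by rewrite square_at_rev 3!square_at_rot. Qed.

Lemma X2_square (c : X2 V) :
  exists i j k l, uniq [:: i; j; k; l] /\ val c = square i j k l.
Proof.
case/existsP: (valP c) => -[[[i j] k] l] /andP[u /eqP cE].
by exists i, j, k, l.
Qed.

Lemma square_atE g (c : X2 V) i j k l :
  val c = square i j k l -> g c = square_at g i j k l.
Proof. by rewrite /square_at => <-; rewrite valK. Qed.

Lemma square_atP i j k l : uniq [:: i; j; k; l] ->
  exists c : X2 V, val c = square i j k l.
Proof.
move=> u; have sq : is_square (square i j k l).
  by apply/existsP; exists (i, j, k, l); rewrite u /=.
by exists (Sub _ sq); rewrite SubK.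
Qed.

Lemma square_at_inj g h :
  (forall i j k l, uniq [:: i; j; k; l] ->
     square_at g i j k l = square_at h i j k l) -> g = h.
Proof.
move=> gh; apply/ffunP => c; have [i [j [k [l [u cE]]]]] := X2_square c.
by rewrite !(square_atE _ cE) gh.
Qed.

Lemma square_atM g h i j k l :
  square_at (g * h) i j k l = square_at g i j k l * square_at h i j k l.
Proof. by rewrite /square_at; case: insub => [c|]; rewrite ?ffunE ?mulg1. Qed.

Lemma square_at_cst i j k l :
  uniq [:: i; j; k; l] -> square_at (cst_opp1 V) i j k l = mu2_opp1.
Proof. by case/square_atP => c cE; rewrite -(square_atE _ cE) ffunE. Qed.

Lemma square_at_delta1 f i j k l : uniq [:: i; j; k; l] ->
  square_at (delta1 f) i j k l =
    edge_at f i j * edge_at f j k * edge_at f k l * edge_at f l i.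
Proof.
by move=> u; case: (square_atP u) => c cE;
  rewrite -(square_atE _ cE) (delta1E _ u).
Qed.

Lemma square_at_vecdelta1 f i j k l :
  f \in vecC1' V -> uniq [:: i; j; k; l] ->
  square_at (vecdelta1 f) i j k l = vecdelta1_at f i j k l.
Proof.
move=> fC u; case: (square_atP u) => c cE.
by rewrite -(square_atE _ cE) (vecdelta1E fC u).
Qed.

(** * Labelled cubes and the cocycle condition *)

Lemma uniq_cube_faces (phi : {ffun cube_vertex -> V}) :
  injective phi -> uniq (cube_faces phi).
Proof.
move=> phiI.
have u x y z w : uniq [:: phi x; phi y; phi z; phi w] = uniq [:: x; y; z; w].
  exact: (map_inj_uniq phiI [:: x; y; z; w]).
rewrite /= !inE !negb_or !andbT -!andbA.
by repeat (apply/andP; split); apply/eqP => /square_dihedral;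
  rewrite !u => /(_ isT isT); rewrite !inE !xpair_eqE !(inj_eq phiI).
Qed.

(** By [square_sub_cube] the squares inside the cube are those of the list of faces, and this list
    has no repetition. *)
Lemma delta2E g (c : X3 V) (phi : {ffun cube_vertex -> V}) :
    injective phi -> val c = cube phi ->
  delta2 g c = \prod_(s <- cube_faces phi)
                 (if insub s is Some c then g c else 1).
Proof.
move=> phiI cE; rewrite ffunE -big_sub_seq ?uniq_cube_faces //.
apply: eq_bigl => s; have [i [j [k [l [u sE]]]]] := X2_square s.
by rewrite cE sE square_sub_cube.
Qed.

(** The cube has (ijkl) and (i'j'k'l') as opposite faces, each vertex being joined to its primed
    copy. *)
Definition cube_at g i j k l i' j' k' l' : mu2 :=
  square_at g i j k l * square_at g i' j' k' l' *
  square_at g i j j' i' * square_at g j k k' j' *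
  square_at g k l l' k' * square_at g l i i' l'.

Lemma cube_faces_prod g i j k l i' j' k' l' :
  square_at g i j k l * (square_at g i' j' k' l' *
  (square_at g i j j' i' * (square_at g l k k' l' *
  (square_at g i l l' i' * square_at g j k k' j')))) =
  cube_at g i j k l i' j' k' l'.
Proof.
rewrite /cube_at [square_at g l k _ _]square_at_flip.
by rewrite [square_at g i l _ _]square_at_flip !mulgA (ACl (1*2*3*6*4*5))%AC.
Qed.

Lemma X3_cube (c : X3 V) : exists i j k l i' j' k' l',
  uniq [:: i; j; k; l; i'; j'; k'; l'] /\
  forall g, delta2 g c = cube_at g i j k l i' j' k' l'.
Proof.
case/existsP: (valP c) => phi /andP[/injectiveP phiI /eqP cE].
exists (phi (false, false, false)), (phi (false, false, true)).
exists (phi (false, true, true)), (phi (false, true, false)).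
exists (phi (true, false, false)), (phi (true, false, true)).
exists (phi (true, true, true)), (phi (true, true, false)).
split=> [|g].
  exact: (map_inj_uniq phiI [:: (false, false, false); (false, false, true);
    (false, true, true); (false, true, false); (true, false, false);
    (true, false, true); (true, true, true); (true, true, false)]).
rewrite (delta2E _ phiI cE) /= !big_cons big_nil mulg1 -!/(square_at _ _ _ _ _).
exact: cube_faces_prod.
Qed.

Lemma cube_atP i j k l i' j' k' l' :
  uniq [:: i; j; k; l; i'; j'; k'; l'] ->
  exists c : X3 V, forall g, delta2 g c = cube_at g i j k l i' j' k' l'.
Proof.
set s := [:: i; _; _; _; _; _; _; _] => us.
(* Each layer is labelled in the cyclic order 00, 01, 11, 10, so that consecutive labels are
   adjacent; the first coordinate selects the layer. *)
pose phi : {ffun cube_vertex -> V} := [ffun p : cube_vertex =>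
  nth i s (4 * p.1.1 + if p.1.2 then if p.2 then 2 else 3 else p.2)].
have phiI : injective phi.
  move=> p q /eqP; rewrite !ffunE nth_uniq //.
  - by case: p q => [[[] []] []] [[[] []] []].
  - by case: p => [[[] []] []].
  - by case: q => [[[] []] []].
have cP : is_cube (cube phi).
  by apply/existsP; exists phi; rewrite eqxx andbT; apply/injectiveP.
exists (Sub _ cP) => g; rewrite (delta2E _ phiI) ?SubK //=.
rewrite !big_cons big_nil mulg1 -!/(square_at _ _ _ _ _) !ffunE /=.
exact: cube_faces_prod.
Qed.

Lemma Z2P g : reflect
  (forall i j k l i' j' k' l', uniq [:: i; j; k; l; i'; j'; k'; l'] ->
     cube_at g i j k l i' j' k' l' = 1)
  (g \in Z2 V).
Proof.
apply: (iffP idP) => [/mker gZ i j k l i' j' k' l' /cube_atP[c <-]|gZ].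
  by rewrite gZ ffunE.
apply/kerP; rewrite ?inE //; apply/ffunP => c; rewrite [RHS]ffunE.
by have [i [j [k [l [i' [j' [k' [l' [u ->]]]]]]]]] := X3_cube c; apply: gZ.
Qed.

(** * The invariant [theta] and its constancy on cocycles *)

(* The sum over the three squares of the K_{2,3} on {a, b} and {x, y, z}. *)
Definition theta g a b x y z : mu2 :=
  square_at g a x b y * square_at g a y b z * square_at g a z b x.

Lemma thetaM g h a b x y z :
  theta (g * h) a b x y z = theta g a b x y z * theta h a b x y z.
Proof.
by rewrite /theta !square_atM !mulgA (ACl (1*3*5*2*4*6))%AC.
Qed.

Lemma theta_sym g a b x y z : theta g a b x y z = theta g b a x y z.
Proof.
by rewrite /theta; congr (_ * _ * _);
  rewrite square_at_swap square_at_rot square_at_rot.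
Qed.

(** Each of the six squares of a K_{2,4} lies in two of its four K_{2,3}. *)
Lemma theta_cocycle g a b x y z t :
  theta g a b x y z * theta g a b x y t * theta g a b x z t * theta g a b y z t
    = 1.
Proof.
rewrite /theta !(square_at_swap g a t) (square_at_swap g a z b x).
mu2_cases (square_at g a x b y); mu2_cases (square_at g a x b z);
mu2_cases (square_at g a x b t); mu2_cases (square_at g a y b z);
mu2_cases (square_at g a y b t); mu2_cases (square_at g a z b t); mu2_solve.
Qed.

(* Each edge of K_{2,3} lies in two of its squares, so each lateral face of the
   prism lies in two of its three cubes. *)
Lemma theta_prism g a b x y z a' b' x' y' z' : g \in Z2 V ->
  uniq [:: a; b; x; y; z; a'; b'; x'; y'; z'] ->
  theta g a b x y z = theta g a' b' x' y' z'.
Proof.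
move=> /Z2P gZ u; apply: mu2_mul_eq1.
(* Each lateral face is written from its vertex [c] or [d], so that the two cubes sharing it produce
   the same term. *)
have side c d p q p' q' c' d' : cube_at g c p d q c' p' d' q' = 1 ->
    square_at g c p d q * square_at g c' p' d' q' =
    square_at g c p p' c' * square_at g d p p' d' *
    (square_at g d q q' d' * square_at g c q q' c').
  rewrite /cube_at (square_at_flip g p d) (square_at_flip g q c) => E.
  by apply: mu2_mul_eq1; rewrite !mulgA.
have := side a b x y x' y' a' b'; have := side a b y z y' z' a' b'.
have := side a b z x z' x' a' b'.
rewrite !gZ; [|distinct..].
move=> /(_ erefl) E3 /(_ erefl) E2 /(_ erefl) E1.
rewrite /theta !mulgA (ACl ((1*4)*(2*5)*(3*6)))%AC /= E1 E2 E3.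
move: (square_at g a x x' a') (square_at g b x x' b') => ax bx.
move: (square_at g a y y' a') (square_at g b y y' b') => ay by'.
move: (square_at g a z z' a') (square_at g b z z' b') => az bz.
by mu2_cases ax; mu2_cases bx; mu2_cases ay; mu2_cases by'; mu2_cases az;
   mu2_cases bz; mu2_solve.
Qed.

(* Disjoint K_{2,3} being comparable, theta only depends on the set of the five
   vertices; summing [theta_cocycle] over two pairs {c, v} and {c, w} of a
   6-element set then allows to exchange v for w. *)
Lemma theta_const g a b x y z a' b' x' y' z' : 10 <= #|V| -> g \in Z2 V ->
  uniq [:: a; b; x; y; z] -> uniq [:: a'; b'; x'; y'; z'] ->
  theta g a b x y z = theta g a' b' x' y' z'.
Proof.
move=> hV gZ.
pose F s := if s is [:: a; b; x; y; z] then theta g a b x y z else 1.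
rewrite -/(F [:: a; b; x; y; z]) -/(F [:: a'; b'; x'; y'; z']) => us ut.
have Fprism s t : size s = 5 -> size t = 5 -> uniq (s ++ t) -> F s = F t.
  case: s t => [|? [|? [|? [|? [|? []]]]]] // [|? [|? [|? [|? [|? []]]]]] //.
  by move=> _ _; apply: theta_prism.
(* Five vertices outside [s] form a prism partner of both lists; this requires ten vertices. *)
have Fperm s t : size s = 5 -> uniq s -> perm_eq s t -> F s = F t.
  move=> s5 {}us st; have [|r [ur r5 rs]] := @exists_uniq_notin V 5 s.
    by rewrite s5.
  have disj q : q =i s -> ~~ has (mem q) r.
    by move=> qs; apply/hasPn => v /rs; rewrite /= qs.
  rewrite (Fprism s r) // ?(Fprism t r) // -?(perm_size st) //.
    by rewrite cat_uniq ur disj -?(perm_uniq st) ?us // => v;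
      rewrite (perm_mem st).
  by rewrite cat_uniq ur disj ?us.
apply: (uniq_seq_connected Fperm) => // v w [|c [|p [|q [|r []]]]] // _ u.
have E (x1 x2 : V) : uniq [:: v; w; c; x1; x2] ->
    theta g c v x1 x2 w = theta g c w x1 x2 v.
  move=> u'; apply: (Fperm [:: _; _; _; _; _] [:: _; _; _; _; _]) => //.
    by distinct.
  by rewrite perm_cons -(perm_rev [:: v; x1; x2; w]) /rev /= (perm_cons w)
             -(perm_rev [:: x2; x1; v]) /rev /= (perm_catC [:: v]).
have := theta_cocycle g c v p q r w; rewrite !E; [|by distinct..].
rewrite -(theta_cocycle g c w p q r v) => /mulIg/mulIg/mulIg.
by rewrite /F (theta_sym g c v) (theta_sym g c w).
Qed.

(** * Functions on ordered pairs and the image of [vecdelta1] *)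

Lemma vec_at_ffun (F : V -> V -> mu2) i j : i != j ->
  vec_at [ffun p : vecX1 V => F (val p).1 (val p).2] i j = F i j.
Proof. by move=> ij; rewrite /vec_at insubT ffunE. Qed.

Lemma vec_atM (f h : cochain (vecX1 V)) i j :
  vec_at (f * h) i j = vec_at f i j * vec_at h i j.
Proof. by rewrite /vec_at; case: insub => [p|]; rewrite ?ffunE ?mulg1. Qed.

Lemma vecdelta1_atM (f h : cochain (vecX1 V)) i j k l :
  vecdelta1_at (f * h) i j k l =
    vecdelta1_at f i j k l * vecdelta1_at h i j k l.
Proof. by rewrite /vecdelta1_at !vec_atM !mulgA (ACl (1*3*5*7*2*4*6*8))%AC. Qed.

Lemma vecdelta1M :
  {in [set: cochain (vecX1 V)] &, {morph @vecdelta1 V : f h / f * h}}.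
Proof.
move=> f h _ _; apply/ffunP => c; rewrite !ffunE.
by case: (xchoose _) => [[[i j] k] l]; rewrite vecdelta1_atM.
Qed.
Canonical vecdelta1_morphism := Morphism vecdelta1M.

(** The readings from [i] and from [j] use every edge in opposite directions, so together they give
    the norm around the cycle. *)
Lemma vecdelta1_at_rot (f : cochain (vecX1 V)) i j k l :
  vecdelta1_at f i j k l * vecdelta1_at f j k l i =
    (vec_at f i j * vec_at f j i) * (vec_at f j k * vec_at f k j) *
    (vec_at f k l * vec_at f l k) * (vec_at f l i * vec_at f i l).
Proof. by rewrite /vecdelta1_at !mulgA (ACl (1*8*5*2*3*6*7*4))%AC. Qed.

Lemma norm_cycle (f : cochain (vecX1 V)) i j k l : uniq [:: i; j; k; l] ->
  square_at (delta1 (norm f)) i j k l =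
    vecdelta1_at f i j k l * vecdelta1_at f j k l i.
Proof.
move=> u; rewrite (square_at_delta1 _ u) !normE; [|by distinct..].
by rewrite vecdelta1_at_rot !mulgA.
Qed.

Lemma vecC1P (f : cochain (vecX1 V)) : reflect
  (forall i j k l, uniq [:: i; j; k; l] ->
     vecdelta1_at f i j k l = vecdelta1_at f j k l i)
  (f \in vecC1' V).
Proof.
rewrite inE; apply: (iffP idP) => [/mker fZ i j k l u | fC].
  apply: mu2_mul_eq1; rewrite -norm_cycle // fZ.
  by have [c cE] := square_atP u; rewrite -(square_atE _ cE) ffunE.
apply/kerP; rewrite ?inE //; apply: square_at_inj => i j k l u.
rewrite norm_cycle // fC // mu2K.
by have [c cE] := square_atP u; rewrite -(square_atE _ cE) ffunE.
Qed.

Lemma vecC1_group_set : group_set (vecC1' V).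
Proof.
apply/group_setP; split=> [|f h /vecC1P fC /vecC1P hC].
  by apply/vecC1P => i j k l _; rewrite /vecdelta1_at /vec_at;
    do 8!(case: insub => [?|]; rewrite ?ffunE ?mulg1).
by apply/vecC1P => i j k l u; rewrite !vecdelta1_atM fC // hC.
Qed.
Canonical vecC1_group := Group vecC1_group_set.

Lemma vecB2E : vecB2 V = @vecdelta1 V @* vecC1' V.
Proof. by rewrite morphimEsub ?subsetT. Qed.

(** The cube graph is bipartite, and every face can be read from its two vertices in one colour
    class. At such a vertex the three faces use the three pairs of its neighbours, so every arc
    occurs twice. *)
Lemma vecB2_Z2 : vecB2 V \subset Z2 V.
Proof.
apply/subsetP => _ /imsetP[f fC ->]; apply/Z2P => i j k l i' j' k' l' u.
rewrite /cube_at (square_at_rot _ i') (square_at_rot _ j k k').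
rewrite (square_at_rot _ l i i') !square_at_vecdelta1 //; try by distinct.
pose p v x y := vec_at f v x * vec_at f v y.
have pC v x y : p v x y = p v y x by apply: mu2C.
have pP v x w y : vecdelta1_at f v x w y = p v x y * p w x y.
  by rewrite /p /vecdelta1_at !mulgA (ACl (1*4*2*3))%AC.
have p3 v x y z : p v x y * p v y z * p v x z = 1.
  rewrite /p; mu2_cases (vec_at f v x); mu2_cases (vec_at f v y);
  by mu2_cases (vec_at f v z); mu2_solve.
clearbody p; rewrite !pP (pC k l) (pC l' l) !mulgA.
rewrite (ACl ((5*11*1)*(7*2*9)*(4*12*10)*(8*6*3)))%AC /=.
by rewrite !p3 !mulg1.
Qed.

(** Read from [a] and [b], each of the six arcs occurs in two of the three squares. *)
Lemma theta_vecdelta1 (f : cochain (vecX1 V)) a b x y z :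
    f \in vecC1' V -> uniq [:: a; b; x; y; z] ->
  theta (vecdelta1 f) a b x y z = 1.
Proof.
move=> fC u; rewrite /theta !square_at_vecdelta1 //; try by distinct.
rewrite /vecdelta1_at.
mu2_cases (vec_at f a x); mu2_cases (vec_at f b x); mu2_cases (vec_at f a y);
mu2_cases (vec_at f b y); mu2_cases (vec_at f a z); mu2_cases (vec_at f b z);
mu2_solve.
Qed.

Lemma theta1_vecB2 g : 5 <= #|V| ->
    (forall a b x y z, uniq [:: a; b; x; y; z] -> theta g a b x y z = 1) ->
  g \in vecB2 V.
Proof.
move=> hV th1; set G := square_at g.
have Grot i j k l : G i j k l = G j k l i := square_at_rot g i j k l.
have Gswap i j k l : G i j k l = G i l k j := square_at_swap g i j k l.
have Gmid i j k l : G i j k l = G j i l k by rewrite Grot Gswap.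
have [//|o _] := @exists_notin V [::]; first by apply: leq_trans hV.
(* First splitting, for the opposite pairs {o, a}. *)
have [H HP] : exists H : V -> V -> mu2, forall a x y,
    uniq [:: o; x; a; y] -> G o x a y = H a x * H a y.
  apply: (@fin_all_exists _ _ (fun a h => forall x y,
    uniq [:: o; x; a; y] -> G o x a y = h x * h y)) => a.
  have [||H HP] := @mu2_coboundary V
    (fun x => [&& a != o, x != o & x != a]) (fun x y => G o x a y).
  - by move=> x y _ _ _; apply: square_at_swap.
  - move=> x y z /and3P[ao xo xa] /and3P[_ yo ya] /and3P[_ zo za] u.
    by apply: (th1 o a); distinct.
  by exists H => x y u; apply: HP; distinct.
(* Two choices [y] and [z] are compared through the square (azby), which [theta] on the pair {z, y}
   expresses by squares through [o]. If no [y] exists, any constant serves. *)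
have KabP a b : exists c : mu2, forall y,
    uniq [:: a; o; b; y] -> G a o b y = c * (H a y * H b y).
  have [y uy | none] := pickP (fun y => uniq [:: a; o; b; y]); last first.
    by exists 1 => y; rewrite none.
  exists (G a o b y * (H a y * H b y)) => z uz.
  have [->|zy] := eqVneq z y; first by rewrite -mulgA mu2K mulg1.
  have ya : G a z b y = H a z * H a y * (H b z * H b y).
    rewrite -!HP; [|by distinct..]; apply: mu2_mul_eq1.
    rewrite (Gmid a) (Gmid o z a) (Grot o z b) mulgA -(th1 z y o a b).
      by rewrite /theta -/G [X in X * _]mu2C.
    by distinct.
  have := th1 a b o y z; rewrite /theta -/G (Gswap a z b o) (Gswap a y) ya.
  move=> /(_ ltac:(distinct)); move: (G a o b y) (G a o b z) => s t.
  mu2_cases s; mu2_cases t; mu2_cases (H a y); mu2_cases (H a z);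
  mu2_cases (H b y); mu2_cases (H b z); mu2_solve.
have [K KP] := fin_all_exists (fun a => fin_all_exists (KabP a)).
(* Second splitting. The triangle identity for [K] is [theta] on the pair {o, y}, where [y] is a
   fifth vertex besides [o], [a], [b], [c]. *)
have [||E EP] := @mu2_coboundary V (predC1 o) K.
- move=> a b ao bo ab; have [|y yn] := @exists_notin V [:: o; a; b].
    exact: leq_trans hV.
  move: ao bo => /= ao bo; apply: (mulIg (H a y * H b y)).
  rewrite -(KP a b); last by distinct.
  rewrite [H a y * _]mu2C -(KP b a); last by distinct.
  by rewrite Gmid Gswap Grot.
- move=> a b c /= ao bo co u; have [|y yn] := @exists_notin V [:: o; a; b; c].
    exact: leq_trans hV.
  have := th1 o y a b c; rewrite /theta -/G -!(Gmid _ o).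
  rewrite (KP a b) ?(KP b c) ?(KP c a); [|by distinct..].
  move=> /(_ ltac:(distinct)) /= <-; move: (K a b) (K b c) (K c a) => s t r.
  by mu2_cases (H a y); mu2_cases (H b y); mu2_cases (H c y); rewrite ?mulg1;
    mu2_cases s; mu2_cases t; mu2_cases r; mu2_solve.
(* f (a, x) is normalised by f (o, x) = 1; the values f (a, o), which this does
   not determine, come from the squares having o as a vertex of the other
   colour. *)
pose F a x := if x == o then E a else if a == o then 1 else H a x.
have FP i j k l : uniq [:: i; j; k; l] ->
    G i j k l = F i j * F k j * F k l * F i l.
  have Fox x : x != o -> F o x = 1 by move=> xo; rewrite /F (negPf xo) eqxx.
  have Fao a : F a o = E a by rewrite /F eqxx.
  have FH a x : a != o -> x != o -> F a x = H a x.
    by move=> ao xo; rewrite /F (negPf xo) (negPf ao).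
  have Fo a b y : uniq [:: a; o; b; y] ->
      G a o b y = F a o * F b o * F b y * F a y.
    move=> u; rewrite (KP a b) // (EP a b); try by distinct.
    rewrite !Fao !FH; try by distinct.
    by rewrite /= -!mulgA [H a y * _]mu2C.
  have oF a x y : uniq [:: o; x; a; y] ->
      G o x a y = F o x * F a x * F a y * F o y.
    by move=> u; rewrite HP // !Fox ?FH ?mulg1 ?mul1g //; distinct.
  move=> u; have [io|io] := eqVneq i o; first by subst; apply: oF.
  have [jo|jo] := eqVneq j o; first by subst; apply: Fo.
  have [ko|ko] := eqVneq k o.
    subst; rewrite 2!Grot oF; last by distinct.
    by rewrite (ACl (3*4*1*2))%AC.
  have [lo|lo] := eqVneq l o.
    subst; rewrite Gswap Fo; last by distinct.
    by rewrite (ACl (4*3*2*1))%AC.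
  rewrite !FH //; apply: mu2_mul_eq1.
  (* A square avoiding [o] is the product of two squares through [o]. *)
  rewrite -(th1 j l o i k); last by distinct.
  rewrite /theta -/G (Gmid j o) -(Grot o) !HP; try by distinct.
  rewrite (Gmid j i); move: (G i j k l) => s.
  by mu2_cases s; mu2_cases (H i j); mu2_cases (H i l); mu2_cases (H k j);
    mu2_cases (H k l); mu2_solve.
pose f : cochain (vecX1 V) := [ffun p : vecX1 V => F (val p).1 (val p).2].
have fP i j k l : uniq [:: i; j; k; l] -> vecdelta1_at f i j k l = G i j k l.
  by move=> u; rewrite /vecdelta1_at !vec_at_ffun ?FP //; distinct.
(* The norm is closed because every reading returns [G], which is invariant under rotation. *)
have fC : f \in vecC1' V.
  by apply/vecC1P => i j k l u; rewrite !fP //; distinct.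
apply/imsetP; exists f => //; apply: square_at_inj => i j k l u.
by rewrite square_at_vecdelta1 ?fP.
Qed.

(** * Comparison of [vecB2] with [B2] *)

Lemma B2_vecB2 : B2 V \subset vecB2 V.
Proof.
apply/subsetP => _ /morphimP[e _ _ ->].
pose f : cochain (vecX1 V) :=
  [ffun p : vecX1 V => edge_at e (val p).1 (val p).2].
have eC i j : edge_at e i j = edge_at e j i by rewrite /edge_at setUC.
have fP i j k l : uniq [:: i; j; k; l] ->
    vecdelta1_at f i j k l = square_at (delta1 e) i j k l.
  move=> u; rewrite square_at_delta1 // /vecdelta1_at.
  by rewrite !(vec_at_ffun (edge_at e)) 1?(eC k j) 1?(eC i l) //; distinct.
have fC : f \in vecC1' V.
  apply/vecC1P => i j k l u; rewrite fP // fP; last by distinct.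
  exact: square_at_rot.
apply/imsetP; exists f => //; apply: square_at_inj => i j k l u.
by rewrite square_at_vecdelta1 ?fP.
Qed.

Lemma edge_at_sym (F : V -> V -> mu2) :
    (forall i j, i != j -> F i j = F j i) ->
  exists e : cochain (X1 V), forall i j, i != j -> edge_at e i j = F i j.
Proof.
move=> FC; have FP (e : X1 V) : exists v, forall i j,
    i != j -> val e = [set i; j] -> F i j = v.
  have /cards2P[a [b [ab ->]]] := valP e; exists (F a b) => i j ij.
  by case/set2_inj => [[-> ->] | [<- <-]] //; rewrite FC // eq_sym.
have [v vP] := fin_all_exists FP.
exists [ffun e : X1 V => v e] => i j ij.
rewrite /edge_at insubT ?cards2 ?ij // => ije; rewrite ffunE.
by apply/esym/vP.
Qed.

(** Closedness is tested on 4-cycles only, whose length is even, so a constant [c] survives beside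
    the coboundary part. *)
Lemma norm_split (f : cochain (vecX1 V)) : 3 <= #|V| -> f \in vecC1' V ->
  exists (c : mu2) (a : V -> mu2), forall i j, i != j ->
    vec_at f i j * vec_at f j i = c * a i * a j.
Proof.
move=> hV /vecC1P fC; pose N i j := vec_at f i j * vec_at f j i.
have NC i j : N i j = N j i by apply: mu2C.
have N4 i j k l : uniq [:: i; j; k; l] -> N i j * N j k * N k l * N l i = 1.
  by move=> /fC E; rewrite /N -vecdelta1_at_rot E mu2K.
have NE i j : vec_at f i j * vec_at f j i = N i j by [].
clearbody N; have [t [ut t3 _]] := @exists_uniq_notin V 3 [::] hV.
case: t t3 ut => [|o [|p [|q []]]] // _ u.
(* The triangle products S are constant, since two triangles with a common edge
   differ by a square. *)
pose S i j := N o i * N i j * N j o.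
have SC i j : S i j = S j i.
  by rewrite /S (NC i j) (NC o i) (NC j o) (ACl (3*2*1))%AC.
have Sadj i j k : uniq [:: o; i; j; k] -> S i j = S j k.
  move=> u'; apply: mu2_mul_eq1; rewrite /S (NC j o) !mulgA.
  by rewrite (ACl (1*2*5*6*(3*4)))%AC /= mu2K mulg1 N4.
have Sp j : j != o -> j != p -> S p j = S p q.
  move=> jo jp; have [-> // | jq] := eqVneq j q.
  by rewrite SC (Sadj j p q) //; distinct.
have Sc i j : i != o -> j != o -> i != j -> S i j = S p q.
  move=> io jo ij; have [ip|ip] := eqVneq i p.
    by rewrite ip Sp // -ip eq_sym.
  have [->|jp] := eqVneq j p; first by rewrite SC Sp.
  by rewrite (Sadj i j p) ?[S j p]SC ?Sp //; distinct.
(* The value at [o] cancels the constant on edges through [o]; on any other edge the formula is the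
   triangle product with [o]. *)
exists (S p q), (fun i => if i == o then S p q else N i o) => i j ij.
rewrite NE.
have [io|io] := eqVneq i o; have [jo|jo] := eqVneq j o.
- by rewrite io jo eqxx in ij.
- by rewrite mu2K mul1g io NC.
- by rewrite [X in X * _]mu2C -mulgA mu2K mulg1 jo.
- rewrite -(Sc i j) // /S (NC j o) (NC o i).
  by mu2_cases (N i j); mu2_cases (N i o); mu2_cases (N o j); mu2_solve.
Qed.

(** A 4-cycle has evenly many edges, so the constant norm -1 is closed. *)
Lemma vecC1_antisymmetric (t : cochain (vecX1 V)) :
    (forall i j, i != j -> vec_at t i j * vec_at t j i = mu2_opp1) ->
  t \in vecC1' V.
Proof.
move=> tP; apply/vecC1P => i j k l u; apply: mu2_mul_eq1.
by rewrite vecdelta1_at_rot !tP; [mu2_solve | distinct..].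
Qed.

(** The constant of [norm_split] decides the coset: multiplication by [t] changes its sign. *)
Lemma vecB2_coset (t f : cochain (vecX1 V)) : 3 <= #|V| ->
    (forall i j, i != j -> vec_at t i j * vec_at t j i = mu2_opp1) ->
    f \in vecC1' V ->
  vecdelta1 f \in B2 V \/ vecdelta1 f * vecdelta1 t \in B2 V.
Proof.
move=> hV tP fC; have tC := vecC1_antisymmetric tP.
(* Multiplying [h] by [a] at the initial vertex makes it symmetric. In a reading of a square each
   initial vertex serves two arcs, so [vecdelta1] is unchanged. *)
have symB (h : cochain (vecX1 V)) (a : V -> mu2) : h \in vecC1' V ->
    (forall i j, i != j -> vec_at h i j * vec_at h j i = a i * a j) ->
    vecdelta1 h \in B2 V.
  move=> hC ha.
  have [|e eP] := @edge_at_sym (fun i j => vec_at h i j * a i).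
    by move=> i j /ha; mu2_cases (vec_at h i j); mu2_cases (vec_at h j i);
       mu2_cases (a i); mu2_cases (a j); mu2_solve.
  suff -> : vecdelta1 h = delta1 e by apply: mem_morphim; rewrite inE.
  apply: square_at_inj => i j k l u.
  rewrite square_at_vecdelta1 // square_at_delta1 // /vecdelta1_at.
  have eC x y : edge_at e x y = edge_at e y x by rewrite /edge_at setUC.
  rewrite (eC j k) (eC l i) !eP; [|by distinct..].
  by mu2_cases (a i); mu2_cases (a k); mu2_cases (vec_at h i j);
    mu2_cases (vec_at h k j); mu2_cases (vec_at h k l);
    mu2_cases (vec_at h i l); mu2_solve.
have [c [a fa]] := norm_split hV fC.
case: (mu2P c) fa => -> fa; [left | right].
  by apply: (symB _ a) => // i j /fa ->; rewrite mul1g.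
rewrite -vecdelta1M ?inE //; apply: (symB _ a); first exact: groupM.
move=> i j ij; rewrite !vec_atM (AC (2*2) ((1*3)*(2*4)))%AC /= fa // tP //.
by mu2_cases (a i); mu2_cases (a j); mu2_solve.
Qed.

(** * Invariants separating the classes *)

Lemma cst_opp1_Z2 : cst_opp1 V \in Z2 V.
Proof.
apply/Z2P => i j k l i' j' k' l' u; rewrite /cube_at !square_at_cst.
all: by [mu2_solve | distinct].
Qed.

Lemma theta_cst a b x y z :
  uniq [:: a; b; x; y; z] -> theta (cst_opp1 V) a b x y z = mu2_opp1.
Proof.
by move=> u; rewrite /theta !square_at_cst ?mu2NN ?mul1g //; distinct.
Qed.

(* The sum over the three squares of K_4. *)
Definition kappa g i j k l : mu2 :=
  square_at g i j k l * square_at g i j l k * square_at g i k j l.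

Lemma kappaM g h i j k l :
  kappa (g * h) i j k l = kappa g i j k l * kappa h i j k l.
Proof. by rewrite /kappa !square_atM !mulgA (ACl (1*3*5*2*4*6))%AC. Qed.

Lemma kappa_cst i j k l :
  uniq [:: i; j; k; l] -> kappa (cst_opp1 V) i j k l = mu2_opp1.
Proof.
by move=> u; rewrite /kappa !square_at_cst ?mu2NN ?mul1g //; distinct.
Qed.

(** With all three squares read from [i], the arcs leaving [i] cancel in pairs. The norm around the
    triangle that remains is the constant of [norm_split]. *)
Lemma kappa_vecdelta1 (f : cochain (vecX1 V)) i j k l :
    f \in vecC1' V -> uniq [:: i; j; k; l] ->
  kappa (vecdelta1 f) i j k l =
    (vec_at f j k * vec_at f k j) * (vec_at f j l * vec_at f l j) *
    (vec_at f k l * vec_at f l k).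
Proof.
move=> fC u; rewrite /kappa !square_at_vecdelta1 //; try by distinct.
rewrite /vecdelta1_at !mulgA.
rewrite (ACl ((1*5)*(4*12)*(8*9)*((10*2)*(11*6)*(3*7))))%AC /=.
by rewrite !mu2K mul1g !mulgA.
Qed.

(** Each edge of K_4 lies in two of its three 4-cycles. *)
Lemma kappa_B2 g i j k l :
  g \in B2 V -> uniq [:: i; j; k; l] -> kappa g i j k l = 1.
Proof.
case/morphimP => e _ _ -> u; rewrite /kappa !square_at_delta1; try by distinct.
have eC x y : edge_at e x y = edge_at e y x by rewrite /edge_at setUC.
rewrite (eC l i) (eC k i) (eC l k) (eC k j).
mu2_cases (edge_at e i j); mu2_cases (edge_at e j k); mu2_cases (edge_at e k l);
by mu2_cases (edge_at e i l); mu2_cases (edge_at e j l);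
  mu2_cases (edge_at e i k); mu2_solve.
Qed.

End Squares.

(** * The orientation given by the linear order *)

Section Ordered.
Import Order.POrderTheory Order.TotalTheory.
Variables (d : Order.disp_t) (V : finOrderType d).
Implicit Types (i j k l : V).

Definition orientation : cochain (vecX1 V) :=
  [ffun p : vecX1 V => if ((val p).1 < (val p).2)%O then 1 else mu2_opp1].

Lemma orientationE i j : i != j ->
  vec_at orientation i j = if (i < j)%O then 1 else mu2_opp1.
Proof. exact: (vec_at_ffun (fun i j => if (i < j)%O then 1 else mu2_opp1)). Qed.

Lemma orientation_norm i j : i != j ->
  vec_at orientation i j * vec_at orientation j i = mu2_opp1.
Proof.
move=> ij; rewrite !orientationE // 1?eq_sym //.
by case: ltgtP ij => //; rewrite ?mul1g ?mulg1.
Qed.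

Lemma orientation_vecC1 : orientation \in vecC1' V.
Proof. exact/vecC1_antisymmetric/orientation_norm. Qed.

(** The left side is the parity of the number of descents around the cycle. This number is odd
    exactly when three consecutive steps go the same way, that is, when the square can be read in
    increasing order. *)
Lemma vecdelta1_orientation :
  vecdelta1 orientation = cst_opp1 V * order_sign V.
Proof.
apply/ffunP => c; transitivity (mu2_opp1 * order_sign V c).
  2: by rewrite !ffunE.
have flip (x y : V) : x != y -> (y < x)%O = ~~ (x < y)%O.
  by move=> xy; rewrite -leNgt le_eqVlt eq_sym (negPf xy).
have oE i j k l : uniq [:: i; j; k; l] -> val c = square i j k l ->
    let s b : mu2 := if b then 1 else mu2_opp1 in
    vecdelta1 orientation c =
      s (i < j)%O * s (~~ (j < k)%O) * s (k < l)%O * s (~~ (l < i)%O).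
  move=> u cE; rewrite (square_atE _ cE).
  rewrite square_at_vecdelta1 ?orientation_vecC1 //.
  by rewrite /vecdelta1_at !orientationE ?(flip j k) ?(flip l i) //; distinct.
rewrite [order_sign V c]ffunE.
case: existsP => [[[[[i j] k] l] /and4P[ij jk kl /eqP cE]] | none].
  have u : uniq [:: i; j; k; l].
    rewrite /= !inE !negb_or !lt_eqF //.
    - exact: lt_trans kl.
    - exact: lt_trans ij (lt_trans jk kl).
    - exact: lt_trans jk.
  rewrite (oE i j k l) // ij jk kl (flip i l) ?(lt_trans ij (lt_trans jk kl));
    by [mu2_solve | distinct].
have no i j k l : val c = square i j k l ->
    [&& (i < j)%O, (j < k)%O & (k < l)%O] = false.
  move=> cE; apply/negP => /and3P[ij jk kl]; case: none.
  by exists (i, j, k, l); rewrite ij jk kl cE /=.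
have [i [j [k [l [u cE]]]]] := X2_square c.
rewrite (oE _ _ _ _ u cE).
(* None of the eight readings is increasing, which leaves two ascents and two descents. *)
have c1 := cE; rewrite square_rot in c1.
have c2 := c1; rewrite square_rot in c2.
have c3 := c2; rewrite square_rot in c3.
have r0 := cE; rewrite square_rev in r0.
have r1 := r0; rewrite square_rot in r1.
have r2 := r1; rewrite square_rot in r2.
have r3 := r2; rewrite square_rot in r3.
move: (no _ _ _ _ cE) (no _ _ _ _ c1) (no _ _ _ _ c2) (no _ _ _ _ c3).
move: (no _ _ _ _ r0) (no _ _ _ _ r1) (no _ _ _ _ r2) (no _ _ _ _ r3).
rewrite (flip i j) ?(flip j k) ?(flip k l) ?(flip l i); [|by distinct..].
by case: (i < j)%O; case: (j < k)%O; case: (k < l)%O; case: (l < i)%O => //=;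
  mu2_solve.
Qed.

End Ordered.

(** * Generators and the isomorphism *)

Theorem theorem6p12 (d : Order.disp_t) (V : finOrderType d) (hV : 10 <= #|V|) :
  [/\ H2 V \isog [set: mu2 * mu2],
      Z2 V = <<cst_opp1 V |: (order_sign V |: B2 V)>> &
      vecB2 V = <<(cst_opp1 V * order_sign V) |: B2 V>>].
Proof.
have gK (g : cochain (X2 V)) : g * g = 1.
  by apply/ffunP => c; rewrite !ffunE mu2K.
have V5 : 5 <= #|V| by apply: leq_trans hV.
have [t [ut t5 _]] := @exists_uniq_notin V 5 [::] V5.
case: t t5 ut => [|a [|b [|x [|y [|z []]]]]] // _ u.
have u4 : uniq [:: a; b; x; y] by distinct.
set w := cst_opp1 V * order_sign V.
have wE : w = vecdelta1 (orientation V) by rewrite vecdelta1_orientation.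
have wB : w \in vecB2 V by rewrite wE; apply: imset_f; apply: orientation_vecC1.
have coset g : g \in vecB2 V -> g \in B2 V \/ g * w \in B2 V.
  case/imsetP => f fC ->; rewrite wE; apply: vecB2_coset fC.
    exact: leq_trans hV.
  exact: orientation_norm.
(* By [theta_const], a single K_{2,3} tests all of them. *)
have thB g : g \in Z2 V -> theta g a b x y z = 1 -> g \in vecB2 V.
  move=> gZ g1; apply: theta1_vecB2 => //.
  by move=> a' b' x' y' z' u'; rewrite -(theta_const hV gZ u u').
have vecBE : vecB2 V = <<w |: B2 V>>.
  apply/eqP; rewrite eqEsubset; apply/andP; split.
    apply/subsetP => g /coset[gB | gwB].
      by rewrite mem_gen // inE gB orbT.
    rewrite -[g]mulg1 -(gK w) mulgA groupM //; apply: mem_gen.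
      by rewrite inE gwB orbT.
    exact: setU11.
  by rewrite vecB2E gen_subG subUset sub1set /= -vecB2E wB B2_vecB2.
have cZ := cst_opp1_Z2 V.
have wZ : w \in Z2 V by apply: (subsetP (vecB2_Z2 V)).
have theta_w : theta w a b x y z = 1.
  by rewrite wE theta_vecdelta1 ?orientation_vecC1.
have kappa_w : kappa w a b x y = mu2_opp1.
  rewrite wE kappa_vecdelta1 ?orientation_vecC1 //.
  by rewrite !orientation_norm; [mu2_solve | distinct..].
split=> //.
  (* On cocycles, trivial [theta] leaves only the cosets of 1 and [w] modulo [B2], and [kappa] tells
     these apart; hence the kernel is [B2]. *)
  pose phi g := (theta g a b x y z, kappa g a b x y).
  have phiM : {in [set: cochain (X2 V)] &, {morph phi : g h / g * h}}.
    by move=> g h _ _; rewrite /phi thetaM kappaM.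
  pose phi_m := Morphism phiM.
  have kerE : 'ker_(Z2 V) phi_m = B2 V.
    apply/setP => g; rewrite in_setI; apply/andP/idP => [[gZ /mker gk]|gB].
      have tg : theta g a b x y z = 1 := congr1 fst gk.
      have kg : kappa g a b x y = 1 := congr1 snd gk.
      case: (coset g (thB g gZ tg)) => // /kappa_B2 /(_ u4).
      by rewrite kappaM kg kappa_w mul1g => /mu2N1.
    have gV := subsetP (B2_vecB2 V) g gB.
    split; first exact: (subsetP (vecB2_Z2 V)).
    apply/kerP; rewrite ?inE //= /phi kappa_B2 //.
    by case/imsetP: gV => f fC ->; rewrite theta_vecdelta1.
  have imE : phi_m @* Z2 V = [set: mu2 * mu2].
    have im g : g \in Z2 V -> phi g \in phi_m @* Z2 V.
      by move=> gZ; apply: (mem_morphim phi_m) => //; rewrite inE.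
    apply/eqP; rewrite eqEsubset subsetT; apply/subsetP => -[s r] _.
    (* The cocycles 1, [w], the constant -1 and the product of the last two realise all pairs of
       signs. *)
    have phi1 : phi 1 = 1 := morph1 phi_m.
    have phiw : phi w = (1, mu2_opp1) by rewrite /phi theta_w kappa_w.
    have phic : phi (cst_opp1 V) = (mu2_opp1, mu2_opp1).
      by rewrite /phi theta_cst ?kappa_cst.
    have phicw : phi (cst_opp1 V * w) = (mu2_opp1, 1).
      by rewrite phiM ?inE // phic phiw; congr (_, _); mu2_solve.
    mu2_cases s; mu2_cases r.
    - by have := im _ (group1 _); rewrite phi1.
    - by have := im _ wZ; rewrite phiw.
    - by have := im _ (groupM cZ wZ); rewrite phicw.
    - by have := im _ cZ; rewrite phic.
  rewrite /H2 -imE -kerE; apply: (first_isog_loc phi_m); exact: subsetT.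
apply/eqP; rewrite eqEsubset; apply/andP; split.
  have sub : vecB2 V \subset <<cst_opp1 V |: (order_sign V |: B2 V)>>.
    rewrite vecBE gen_subG subUset sub1set; apply/andP; split.
      by rewrite groupM // mem_gen // !inE eqxx ?orbT.
    by apply/subsetP => g gB; rewrite mem_gen // !inE gB !orbT.
  apply/subsetP => g gZ; case: (mu2P (theta g a b x y z)) => tg.
    by apply: (subsetP sub); apply: thB.
  (* If [theta] is -1, multiplication by the constant -1 moves [g] into [vecB2]. *)
  rewrite -[g]mulg1 -(gK (cst_opp1 V)) mulgA groupM //.
    apply: (subsetP sub); apply: thB; first exact: groupM.
    by rewrite thetaM tg theta_cst ?mu2NN.
  by rewrite mem_gen // !inE eqxx.
rewrite gen_subG !subUset !sub1set cZ /=; apply/andP; split.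
  (* The cocycle condition, known for [w], passes to [order_sign V] through the constant. *)
  have -> : order_sign V = cst_opp1 V * w by rewrite /w mulgA gK mul1g.
  exact: groupM.
exact: subset_trans (B2_vecB2 V) (vecB2_Z2 V).
Qed.
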